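(* Let $q=nv+1$ be a prime power (with $n,v$ positive integers) and let $k>2$. Assume that there exists a cyclic $(R_{q,v},k,1)$ difference family all of whose base blocks are zero-sum in $\mathbb{F}_q$. Then there exists an $\mathrm{EA}(q)$-additive $(v,k,1)$-design.
   Context: A $(v,k,1)$-design is a pair $(V,\mathcal{B})$ with $V$ a $v$-set and $\mathcal{B}$ a collection of $k$-subsets of $V$ such that every pair of distinct points lies in exactly one block ($v>k>2$). $\mathrm{EA}(q)$ is the elementary abelian group of order $q$, i.e. the additive group of $\mathbb{F}_q$. A design is $\mathrm{EA}(q)$-additive if, up to isomorphism, its points are elements of $\mathrm{EA}(q)$ and every block sums to $0$. For $q\equiv 1 \pmod{m}$, $R_{q,m}$ is the subgroup of order $m$ of the multiplicative group $\mathbb{F}_q^*$ (the $m$-th roots of unity). For a multiplicative group $G$ and a set $\mathcal{F}$ of subsets of $G$, the list of differences $\Delta\mathcal{F}$ is the multiset of all ratios $xy^{-1}$ with $(x,y)$ an ordered pair of distinct elements of the same member of $\mathcal{F}$. For a subgroup $H$ of $G$, a $(G,H,k,1)$ difference family is a set of $k$-subsets of $G$ (base blocks) whose list of differences is exactly $G\setminus H$ (each element once). A cyclic $(G,k,1)$ difference family is a $(G,H,k,1)$ difference family where $G$ is cyclic of order $v\equiv 1$ or $k \pmod{k(k-1)}$ and $H$ is the subgroup of $G$ of order $1$ or $k$, respectively. *)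

(* Defs.v *)
From HB Require Import structures.
From mathcomp Require Import all_boot all_order all_algebra.
From mathcomp Require Import all_fingroup all_solvable all_field.

Set Implicit Arguments.
Unset Strict Implicit.
Unset Printing Implicit Defensive.

Import GroupScope GRing.Theory.

(* Collections of blocks are sets of sets: for k > 1 and index 1 no block can
   be repeated, so nothing is lost with respect to multisets of blocks. *)
Definition is_design (T : finType) (v k : nat)
    (V : {set T}) (Bs : {set {set T}}) : Prop :=
  [/\ 2 < k, k < v, #|V| = v,
      forall B, B \in Bs -> B \subset V /\ #|B| = k
    & forall x y, x \in V -> y \in V -> x != y ->
        exists! B : {set T}, [/\ B \in Bs, x \in B & y \in B]].

Definition design_iso (T T' : finType)
    (V : {set T}) (Bs : {set {set T}})
    (V' : {set T'}) (Bs' : {set {set T'}}) : Prop :=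
  exists f : T -> T',
    [/\ {in V &, injective f}, f @: V = V'
      & [set f @: (B : {set T}) | B in Bs] = Bs'].

(* For A a field with q elements, this is EA(q)-additivity: only the additive
   group of the field is used. *)
Definition additive_design (A : finZmodType) (T : finType)
    (V : {set T}) (Bs : {set {set T}}) : Prop :=
  exists (V' : {set A}) (Bs' : {set {set A}}),
    design_iso V Bs V' Bs' /\
    forall B, B \in Bs' -> (\sum_(x in B) x = 0)%R.

(* As a sequence, i.e. with multiplicities; only meaningful up to perm_eq. *)
Definition list_of_differences (gT : finGroupType)
    (Fam : {set {set gT}}) : seq gT :=
  [seq p.1 * p.2^-1 | B : {set gT} <- enum Fam,
     p <- enum [set p : gT * gT | [&& p.1 \in B, p.2 \in B & p.1 != p.2]]].

Definition difference_family (gT : finGroupType) (G H : {group gT})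
    (k : nat) (Fam : {set {set gT}}) : Prop :=
  [/\ H \subset G,
      forall B, B \in Fam -> B \subset G /\ #|B| = k
    & perm_eq (list_of_differences Fam) (enum (G :\: H))].

(* A cyclic group has at most one subgroup of each order, so the existential
   over H denotes "the" subgroup of order 1 or k. *)
Definition cyclic_difference_family (gT : finGroupType) (G : {group gT})
    (k : nat) (Fam : {set {set gT}}) : Prop :=
  cyclic G /\
  exists H : {group gT},
    difference_family G H k Fam /\
    (   (#|G| = 1 %[mod k * (k - 1)] /\ #|H| = 1%N)
     \/ (#|G| = k %[mod k * (k - 1)] /\ #|H| = k)).

Definition roots_of_unity_set (F : finFieldType) (m : nat) : {set {unit F}} :=
  [set u | u ^+ m == 1].

Fact roots_of_unity_group_set (F : finFieldType) (m : nat) :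
  group_set (roots_of_unity_set F m).
Proof.
apply/group_setP; split=> [|x y]; first by rewrite inE expg1n.
rewrite !inE => /eqP x1 /eqP y1; rewrite expgMn ?x1 ?y1 ?mulg1 //.
by apply: val_inj; rewrite /= GRing.mulrC.
Qed.

(* R_{q,m}, with q = #|F|. *)
Definition roots_of_unity (F : finFieldType) (m : nat) : {group {unit F}} :=
  Group (roots_of_unity_group_set F m).

Lemma card_roots_of_unity (F : finFieldType) (m : nat) :
  m %| #|F| - 1 -> #|roots_of_unity F m| = m.
Proof.
rewrite subn1 -card_finField_unit => m_dv.
have m_gt0 : 0 < m by apply: dvdn_gt0 m_dv; apply: cardG_gt0.
have cyc (K : {group {unit F}}) : cyclic K by apply: field_unit_group_cyclic.
apply/eqP; rewrite eqn_leq; apply/andP; split.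
  have /cyclicP[y Ry] := cyc (roots_of_unity F m).
  rewrite Ry; apply: dvdn_leq => //; rewrite order_dvdn.
  by have := cycle_id y; rewrite -Ry inE.
have /cyclicP[x Ux] := cyc [set: {unit F}]%G.
have Ux' : #|[set: {unit F}]| = #[x] by rewrite [in LHS]Ux.
rewrite Ux' in m_dv.
have om : #[x ^+ (#[x] %/ m)] = m.
  by rewrite orderXdiv ?dvdn_div // divnA // mulKn.
rewrite -[X in X <= _]om; apply: subset_leq_card.
by rewrite cycle_subG inE -expgM divnK // expg_order.
Qed.

Definition zero_sum_family (F : finFieldType) (Fam : {set {set {unit F}}}) :
    Prop :=
  forall B, B \in Fam -> (\sum_(u in B) FinRing.uval u = 0 :> F)%R.

(* Main.v *)
(** Let G be the group of v-th roots of unity and H the subgroup of the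
    difference family.  The translates B g of the base blocks cover each pair
    {x, y} with x/y outside H exactly once, and when |H| = k the cosets of H
    cover the remaining pairs.  A translate multiplies the sum of a block by a
    unit, so zero sums are preserved; and the sum over a nontrivial subgroup of
    F^* vanishes, being invariant under multiplication by an element other
    than 1. *)
Require Import Defs.
From HB Require Import structures.
From mathcomp Require Import all_boot all_order all_algebra.
From mathcomp Require Import all_fingroup all_solvable all_field.

Set Implicit Arguments.
Unset Strict Implicit.
Unset Printing Implicit Defensive.

Import GRing.Theory.

(** Turns the absence of repetitions in the list of differences into uniqueness of the base pair
    behind each quotient. *)
Lemma map_uniq_inj (T1 T2 : eqType) (f : T1 -> T2) (s : seq T1) :
  uniq (map f s) -> {in s &, injective f}.
Proof.
elim: s => //= a s IHs /andP[fa_s /IHs injf] x y.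
rewrite !inE => /predU1P[->|xs] /predU1P[->|ys] //; last exact: injf.
- by move=> fay; rewrite fay map_f in fa_s.
- by move=> fxa; rewrite -fxa map_f in fa_s.
Qed.

Section Development.

Local Open Scope group_scope.

Variables (gT : finGroupType) (G H : {group gT}) (k : nat).
Variable Fam : {set {set gT}}.
Hypothesis famDF : difference_family G H k Fam.

Lemma quotient_base_block (B : {set gT}) (a b : gT) :
  B \in Fam -> a \in B -> b \in B -> a != b -> a * b^-1 \in G :\: H.
Proof.
case: famDF => _ _ /perm_mem eqD BF aB bB ab.
rewrite -mem_enum -eqD; apply/allpairsPdep; exists B, (a, b).
by rewrite !mem_enum inE /= aB bB ab.
Qed.

Lemma quotient_base_block_surj (d : gT) : d \in G :\: H ->
  exists B a b, [/\ B \in Fam, a \in B, b \in B & d = a * b^-1].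
Proof.
case: famDF => _ _ /perm_mem eqD; rewrite -mem_enum -eqD.
case/allpairsPdep=> B [[a b] []]; rewrite !mem_enum inE /=.
by move=> BF /and3P[aB bB _] ->; exists B, a, b.
Qed.

Lemma quotient_base_block_inj (B B' : {set gT}) (a b a' b' : gT) :
    B \in Fam -> a \in B -> b \in B -> a != b ->
    B' \in Fam -> a' \in B' -> b' \in B' -> a' != b' ->
  a * b^-1 = a' * b'^-1 -> B = B' /\ b = b'.
Proof.
case: famDF => _ _ /perm_uniq; rewrite enum_uniq => uniqD.
move=> BF aB bB ab BF' aB' bB' ab' eqd.
pose pairs (C : {set gT}) :=
  enum [set p : gT * gT | [&& p.1 \in C, p.2 \in C & p.1 != p.2]].
(* Each pair is tagged with its block, so that injectivity on [s] recovers the block as well; the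
   quotients along [s] form exactly the list of differences. *)
pose s := [seq (C, p) | C <- enum Fam, p <- pairs C].
have inj_s : {in s &, injective (fun t : {set gT} * (gT * gT) =>
    t.2.1 * t.2.2^-1)}.
  by apply: map_uniq_inj; rewrite map_allpairs.
have mem_s C c d : C \in Fam -> c \in C -> d \in C -> c != d ->
    (C, (c, d)) \in s.
  move=> CF cC dC cd; apply/allpairsPdep; exists C, (c, d).
  by rewrite !mem_enum inE /= cC dC cd.
by case: (inj_s _ _ (mem_s _ _ _ BF aB bB ab) (mem_s _ _ _ BF' aB' bB' ab') eqd).
Qed.

Definition development : {set {set gT}} := [set B :* g | B in Fam, g in G].

(* Cosets of the trivial subgroup cover no pair and have the wrong size. *)
Definition completed_development : {set {set gT}} :=
  development :|: (if #|H| == k then rcosets H G else set0).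

(** A right translation cancels in quotients: [a * g * (b * g)^-1 = a * b^-1]. *)
Lemma development_quotient (g x y : gT) (B : {set gT}) :
    B \in Fam -> x \in B :* g -> y \in B :* g -> x != y ->
  x * y^-1 \in G :\: H.
Proof.
move=> BF /rcosetP[a aB ->] /rcosetP[b bB ->] /eqP xy.
rewrite invMg mulgA mulgK; apply: (quotient_base_block BF) => //.
by apply/eqP=> ab; case: xy; rewrite ab.
Qed.

(** Translating back by [g] and by [g'] gives two base pairs with the same quotient [x * y^-1]. They
    must coincide, so [B = B'] and [y * g^-1 = y * g'^-1], whence [g = g']. *)
Lemma development_inj (B B' : {set gT}) (g g' x y : gT) :
    B \in Fam -> B' \in Fam -> x != y ->
    x \in B :* g -> y \in B :* g -> x \in B' :* g' -> y \in B' :* g' ->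
  B :* g = B' :* g'.
Proof.
move=> BF BF' xy; rewrite !mem_rcoset => xB yB xB' yB'.
have neq h : x * h^-1 != y * h^-1 by rewrite (inj_eq (mulIg _)).
have eq_quot : x * g^-1 * (y * g^-1)^-1 = x * g'^-1 * (y * g'^-1)^-1.
  by rewrite !invMg !invgK !mulgA !mulgKV.
have [-> /mulgI/invg_inj->//] :=
  quotient_base_block_inj BF xB yB (neq g) BF' xB' yB' (neq g') eq_quot.
Qed.

Lemma completed_development_design :
    2 < k -> k < #|G| -> #|H| = 1%N \/ #|H| = k ->
  is_design #|G| k G completed_development.
Proof.
move=> k2 kG cardH; case: (famDF) => HG baseB _.
split=> // [C | x y xG yG xy].
  case/setUP=> [/imset2P[B g /baseB[BG cardB] gG ->] | ].
    by rewrite card_rcoset cardB mul_subG // sub1set.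
  case: eqP => [<- | _]; last by rewrite inE.
  by case/rcosetsP=> g gG ->; rewrite card_rcoset mul_subG // sub1set.
have [xyH | xyNH] := boolP (x * y^-1 \in H).
  (* Distinct points with quotient in [H] rule out the trivial subgroup, so the cosets of [H] are
     blocks. *)
  have Hk : #|H| == k.
    case: cardH => [H1 | ->//]; move: xyH.
    by rewrite (card1_trivg H1) inE -eq_mulgV1 (negPf xy).
  exists (H :* y); split.
    split; rewrite ?mem_rcoset ?mulgV //.
    by rewrite inE Hk; apply/orP; right; apply/rcosetsP; exists y.
  (* Translates of base blocks only yield quotients outside [H], so [C] is a coset, namely the one
     through [y]. *)
  move=> C []; rewrite /completed_development Hk.
  case/setUP=> [/imset2P[B g BF gG ->] xB yB | /rcosetsP[g _ ->] _ yHg].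
    by have := development_quotient BF xB yB xy; rewrite inE xyH.
  by apply/esym/rcoset_eqP; rewrite rcoset_sym.
have xyD : x * y^-1 \in G :\: H by rewrite inE xyNH groupM ?groupV.
have [B [a [b [BF aB bB eqab]]]] := quotient_base_block_surj xyD.
have bG : b \in G by case: (baseB _ BF) => /subsetP/(_ b bB).
(* The translation by [b^-1 * y] carries [b] to [y], and [a] to [a * b^-1 * y = x]. *)
have xBg : x \in B :* (b^-1 * y).
  by rewrite mem_rcoset invMg invgK mulgA eqab mulgKV.
have yBg : y \in B :* (b^-1 * y).
  by rewrite mem_rcoset invMg invgK mulgA mulgV mul1g.
exists (B :* (b^-1 * y)); split.
  split=> //; rewrite inE; apply/orP; left; apply/imset2P.
  by exists B (b^-1 * y); rewrite ?groupM ?groupV.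
move=> C [/setUP[/imset2P[B' g BF' gG ->] xC yC | ]].
  exact: development_inj BF BF' xy xBg yBg xC yC.
case: eqP => _; last by rewrite inE.
(* Two elements of one coset of [H] have their quotient in [H], which is excluded here. *)
case/rcosetsP=> g _ -> /rcosetP[h hH eqx] /rcosetP[h' hH' eqy].
case/negP: xyNH.
by rewrite eqx eqy invMg mulgA mulgK groupM ?groupV.
Qed.

End Development.

Section ZeroSums.

Local Open Scope group_scope.

Variable F : finFieldType.
Implicit Types (B : {set {unit F}}) (g : {unit F}) (H : {group {unit F}}).

Lemma sum_rcoset_units B g :
  (\sum_(u in B :* g) FinRing.uval u
    = (\sum_(u in B) FinRing.uval u) * FinRing.uval g :> F)%R.
Proof.
rewrite -rcosetE big_imset /=; last by move=> x y _ _; apply: mulIg.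
by rewrite mulr_suml.
Qed.

Lemma sum_nontrivial_unit_group H :
  1 < #|H| -> (\sum_(u in H) FinRing.uval u = 0 :> F)%R.
Proof.
rewrite cardG_gt1 => /trivgPn[h hH h1].
have := sum_rcoset_units H h; rewrite (rcoset_id hH) => /eqP.
(* With S the sum over [H], the equation S = S h becomes S (1 - h) = 0. *)
rewrite -subr_eq0 -[X in (X - _)%R]mulr1 -mulrBr mulf_eq0 subr_eq0.
case/orP=> [/eqP//|/eqP h_eq1].
by case/eqP: h1; apply: val_inj.
Qed.

End ZeroSums.

Theorem theorem2p3 (p e q n v k : nat) (F : finFieldType)
  (hp : prime p) (he : 0 < e) (hq : q = p ^ e)
  (hn : 0 < n) (hv : 0 < v) (hqnv : q = n * v + 1)
  (hF : #|F| = q)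
  (hk : 2 < k) (hkv : k < v)
  (hDF : exists Fam : {set {set {unit F}}},
     cyclic_difference_family (roots_of_unity F v) k Fam /\
     zero_sum_family Fam) :
  exists (T : finType) (V : {set T}) (Bs : {set {set T}}),
    is_design v k V Bs /\ additive_design F V Bs.
Proof.
have [Fam [[_ [H [famDF cardH]]] zsF]] := hDF.
have cardG : #|roots_of_unity F v| = v.
  by apply: card_roots_of_unity; rewrite hF hqnv addnK dvdn_mull.
pose V : {set {unit F}} := roots_of_unity F v.
pose Bs := completed_development (roots_of_unity F v) H k Fam.
exists {unit F}, V, Bs; split.
  rewrite -[X in is_design X]cardG; apply: completed_development_design => //.
    by rewrite cardG.
  by case: cardH => [] [_ ->]; [left | right].
(* The isomorphism is the inclusion of the unit group in the field, whose additive group is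
   EA(q). *)
exists ((@FinRing.uval F) @: V), [set (@FinRing.uval F) @: (B : {set _}) | B in Bs].
split; first by exists (@FinRing.uval F); split=> // x y _ _ /val_inj.
move=> _ /imsetP[C CBs ->].
rewrite big_imset /=; last by move=> x y _ _ /val_inj.
case/setUP: CBs => [/imset2P[B g BF _ ->] | ].
  by rewrite sum_rcoset_units zsF // mul0r.
case: eqP => [Hk | _]; last by rewrite inE.
case/rcosetsP=> g _ ->.
(* [H] is nontrivial because its order is [k > 2]. *)
by rewrite sum_rcoset_units sum_nontrivial_unit_group ?mul0r // Hk ltnW.
Qed.
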